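(* Let $R$ and $S$ be commutative rings with non-zero identity, $f:R\to S$ a ring homomorphism, and $J$ an ideal of $S$ with $J\subseteq J(S)$. Then every $J$-ideal of $R\Join^f J$ containing $\{0\}\times J$ is of the form $I\Join^f J$ where $I$ is a $J$-ideal of $R$.
   Context: $J(A)$ denotes the Jacobson radical of a ring $A$. The term ''$J$-ideal'' refers to the Jacobson radical, not to the ideal named $J$: a proper ideal $I$ of a ring $A$ is a $J$-ideal if whenever $a,b\in A$ with $ab\in I$ and $a\notin J(A)$, then $b\in I$. The amalgamation of $R$ and $S$ along $J$ with respect to $f$ is the subring $R\Join^f J=\{(r,f(r)+j): r\in R, j\in J\}$ of $R\times S$. For an ideal $I$ of $R$, $I\Join^f J=\{(i,f(i)+j): i\in I, j\in J\}$, an ideal of $R\Join^f J$. *)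

(* Defs.v *)
From HB Require Import structures.
From mathcomp Require Import all_boot all_algebra.
From mathcomp Require Import boolp classical_sets.

Set Implicit Arguments.
Unset Strict Implicit.
Unset Printing Implicit Defensive.

Import GRing.Theory.
Local Open Scope classical_set_scope.
Local Open Scope ring_scope.

(* [A^o] is [A] as a module over itself: [ideal I] allows [I = setT], whereas
   the library's [idealr_closed] characterizes the proper ideals. *)
Definition ideal (A : comNzRingType) (I : set A) : Prop :=
  @submod_closed A A^o [in I].

Lemma idealP (A : comNzRingType) (I : set A) :
  ideal I <-> [/\ I 0, forall x y, I x -> I y -> I (x + y)
                & forall a x, I x -> I (a * x)].
Proof.
rewrite /ideal; split.
  case=> /set_mem I0 IP.
  have IL a x y : I x -> I y -> I (a * x + y).
    by move=> Ix Iy; apply/set_mem/IP; apply: mem_set.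
  split=> // [x y Ix Iy|a x Ix]; first by rewrite -[x]mul1r; apply: IL.
  by rewrite -[_ * _]addr0; apply: IL.
case=> I0 ID IM; split; first exact: mem_set.
by move=> a x y /set_mem Ix /set_mem Iy; apply/mem_set/ID => //; apply: IM.
Qed.

Lemma idealr_closedP (A : comNzRingType) (I : set A) :
  idealr_closed [in I] <-> ideal I /\ ~ I 1.
Proof.
split; first by case=> I0 /negP I1 IP; split=> // /mem_set.
by case=> -[I0 IP] I1; split=> //; apply/negP => /set_mem.
Qed.

Definition maximal_ideal (A : comNzRingType) (M : set A) : Prop :=
  idealr_closed [in M] /\ forall N, idealr_closed [in N] -> M `<=` N -> N = M.

Definition jacobson (A : comNzRingType) : set A :=
  \bigcap_(M in @maximal_ideal A) M.
Arguments jacobson A : clear implicits.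

(* The J stands for the Jacobson radical, not for the ideal [J] below. *)
Definition J_ideal (A : comNzRingType) (I : set A) : Prop :=
  idealr_closed [in I] /\ forall a b, I (a * b) -> ~ jacobson A a -> I b.

(* With [I = setT] this is the carrier of the amalgamation itself. *)
Definition amalg_set (R S : comNzRingType) (f : {rmorphism R -> S})
    (I : set R) (J : set S) : set (R * S) :=
  [set (i, f i + j) | i in I & j in J].

Lemma amalg_subring (R S : comNzRingType) (f : {rmorphism R -> S})
    (J : set S) (hJ : ideal J) : subring_closed [in amalg_set f setT J].
Proof.
have /idealP [J0 JD JM] := hJ.
have JN x : J x -> J (- x) by rewrite -mulN1r; exact: JM.
split.
- by apply/mem_set; exists 1 => //; exists 0 => //; rewrite rmorph1 addr0.
- move=> _ _ /set_mem [r _ [j Jj <-]] /set_mem [s _ [k Jk <-]].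
  apply/mem_set; exists (r - s) => //; exists (j - k); first exact/JD/JN.
  by congr pair; rewrite rmorphB /= addrACA -opprD.
- move=> _ _ /set_mem [r _ [j Jj <-]] /set_mem [s _ [k Jk <-]].
  apply/mem_set; exists (r * s) => //.
  exists (f s * j + (f r + j) * k); first by apply: JD; apply: JM.
  by congr pair; rewrite /= rmorphM [RHS]mulrDr
    [X in _ = X + _]mulrDl (mulrC (f s)) addrA.
Qed.

(* The proof [hJ] only serves to find the ring structure of [amalg f hJ]. *)
Definition amalg (R S : comNzRingType) (f : {rmorphism R -> S})
    (J : set S) (hJ : ideal J) : Type :=
  {x : R * S | x \in amalg_set f setT J}.

Section AmalgRing.
Variables (R S : comNzRingType) (f : {rmorphism R -> S}).
Variables (J : set S) (hJ : ideal J).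

HB.instance Definition _ := SubChoice.on (amalg f hJ).
HB.instance Definition _ := GRing.SubChoice_isSubComNzRing.Build
  (R * S)%type [in amalg_set f setT J] (amalg f hJ) (amalg_subring f hJ).

End AmalgRing.

Definition amalg_ideal (R S : comNzRingType) (f : {rmorphism R -> S})
    (J : set S) (hJ : ideal J) (I : set R) : set (amalg f hJ) :=
  [set x | amalg_set f I J (val x)].
Arguments amalg_ideal {R S} f {J} hJ I.

Lemma amalg_ideal_ideal (R S : comNzRingType) (f : {rmorphism R -> S})
    (J : set S) (hJ : ideal J) (I : set R) :
  ideal I -> ideal (amalg_ideal f hJ I).
Proof.
have /idealP [J0 JD JM] := hJ.
move=> /idealP [I0 ID IM]; apply/idealP; split.
- by exists 0 => //; exists 0 => //; rewrite !raddf0 ?addr0.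
- move=> x y [i Ii [j Jj e]] [k Ik [l Jl e']]; rewrite /amalg_ideal /=.
  exists (i + k); first exact: ID.
  exists (j + l); first exact: JD.
  by rewrite -[RHS]/(val x + val y) -e -e'; congr pair; rewrite rmorphD /= addrACA.
- move=> a x [i Ii [j Jj e]]; rewrite /amalg_ideal /=.
  have /set_mem [r _ [k Jk e']] := valP a.
  exists (r * i); first exact: IM.
  exists (f i * k + (f r + k) * j); first by apply: JD; apply: JM.
  rewrite -[RHS]/(val a * val x) -e -e'; congr pair; rewrite /=.
  by rewrite rmorphM [RHS]mulrDr [X in _ = X + _]mulrDl (mulrC (f i)) addrA.
Qed.

(* Main.v *)
Require Import Defs.
From HB Require Import structures.
From mathcomp Require Import all_boot all_algebra.
From mathcomp Require Import boolp classical_sets.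

Set Implicit Arguments.
Unset Strict Implicit.
Unset Printing Implicit Defensive.

Import GRing.Theory.
Local Open Scope classical_set_scope.
Local Open Scope ring_scope.

(** The projection [p : (r, f r + j) |-> r] is a surjective ring morphism with
    section [s : r |-> (r, f r)].  Maximal ideals pull back along the surjection
    [p] to maximal ideals, so [p] maps Jacobson radical into Jacobson radical;
    hence [s] reflects membership in the Jacobson radical, and the preimage of
    a J-ideal under [s] is a J-ideal.  Since [K] contains the kernel [0 x J] of
    [p], an element [x] lies in [K] iff [s (p x)] does. *)

Lemma idealr_closed_preimage (A B : comNzRingType) (g : {rmorphism A -> B})
    (M : set B) :
  idealr_closed [in M] -> idealr_closed [in g @^-1` M].
Proof.
move=> /idealr_closedP [/idealP [M0 MD MM] M1]; apply/idealr_closedP; split.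
  apply/idealP; split => [|x y|a x] /=; first by rewrite rmorph0.
    by rewrite rmorphD; exact: MD.
  by rewrite rmorphM; exact: MM.
by rewrite /= rmorph1.
Qed.

Section Surjection.
Variables (A B : comNzRingType) (p : {rmorphism A -> B}) (s : B -> A).
Hypothesis sK : cancel s p.

(** Surjectivity gives stability under multiplication: a multiplier [b] in [B] lifts to [s b], and
    [b * p x = p (s b * x)]. *)
Lemma ideal_image (N : set A) : ideal N -> ideal (p @` N).
Proof.
move=> /idealP [N0 ND NM]; apply/idealP; split.
- by exists 0 => //; rewrite rmorph0.
- move=> _ _ [x Nx <-] [y Ny <-]; exists (x + y); first exact: ND.
  by rewrite rmorphD.
- move=> b _ [x Nx <-]; exists (s b * x); first exact: NM.
  by rewrite rmorphM sK.
Qed.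

Lemma maximal_ideal_preimage (M : set B) :
  maximal_ideal M -> maximal_ideal (p @^-1` M).
Proof.
move=> [Mid Mmax]; split; first exact: idealr_closed_preimage.
move=> N /idealr_closedP [Nid N1] MN.
have /idealP [N0 ND NM] := Nid.
have /idealr_closedP [/idealP [M0 _ _] _] := Mid.
(* The image of [N] stays proper because [N] contains the kernel of [p]: if [p x = 1] with [x] in
   [N], then [1 - x] is in the kernel, so [1] is in [N]. *)
have pN1 : ~ (p @` N) 1.
  move=> [x Nx px1]; apply: N1; rewrite -(subrK x 1); apply: ND => //.
  by apply: MN; rewrite /= rmorphB rmorph1 px1 subrr.
have pNM : p @` N = M.
  apply: Mmax; first by apply/idealr_closedP; split; first exact: ideal_image.
  by move=> y My; exists (s y); [apply: MN; rewrite /= sK | rewrite sK].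
by rewrite eqEsubset; split=> // x Nx; rewrite /= -pNM; exists x.
Qed.

Lemma jacobson_image (a : A) : jacobson A a -> jacobson B (p a).
Proof. by move=> aJ M /maximal_ideal_preimage; exact: aJ. Qed.

End Surjection.

Lemma J_ideal_preimage_section (A B : comNzRingType) (p : {rmorphism A -> B})
    (s : {rmorphism B -> A}) (K : set A) :
  cancel s p -> J_ideal K -> J_ideal (s @^-1` K).
Proof.
move=> sK [Kid KJ]; split; first exact: idealr_closed_preimage.
(* If [s a] were in the radical of [A], then [a = p (s a)] would be in that of [B]. *)
move=> a b; rewrite /= rmorphM => /KJ Kb aJ; apply: Kb => /(jacobson_image sK).
by rewrite sK.
Qed.

Section Amalgamation.
Variables (R S : comNzRingType) (f : {rmorphism R -> S}).
Variables (J : set S) (hJ : ideal J).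

Lemma amalg_graph_subproof (r : R) : (r, f r) \in amalg_set f setT J.
Proof.
have /idealP [J0 _ _] := hJ.
by apply/mem_set; exists r => //; exists 0 => //; rewrite addr0.
Qed.

Definition amalg_graph (r : R) : amalg f hJ :=
  exist _ (r, f r) (amalg_graph_subproof r).

Lemma amalg_graph_is_zmod_morphism : zmod_morphism amalg_graph.
Proof. by move=> r t; apply: val_inj; rewrite rmorphB /= rmorphB. Qed.

Lemma amalg_graph_is_monoid_morphism : monoid_morphism amalg_graph.
Proof.
split; first by apply: val_inj; rewrite rmorph1 /= rmorph1.
by move=> r t; apply: val_inj; rewrite rmorphM /= rmorphM.
Qed.

HB.instance Definition _ := GRing.isZmodMorphism.Build R (amalg f hJ)
  amalg_graph amalg_graph_is_zmod_morphism.
HB.instance Definition _ := GRing.isMonoidMorphism.Build R (amalg f hJ)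
  amalg_graph amalg_graph_is_monoid_morphism.

Definition amalg_fst : {rmorphism amalg f hJ -> R} :=
  (@fst R S \o (val : amalg f hJ -> R * S)%type).

Lemma amalg_graphK : cancel amalg_graph amalg_fst.
Proof. by []. Qed.

Lemma amalg_ideal_preimage_graph (K : set (amalg f hJ)) :
  ideal K -> [set 0] `*` J `<=` [set val x | x in K] ->
  K = amalg_ideal f hJ (amalg_graph @^-1` K).
Proof.
move=> /idealP [K0 KD KM] hcont.
have JN j : J j -> J (- j).
  by have /idealP [_ _ JM] := hJ; rewrite -mulN1r; exact: JM.
(* [K] is stable under translation by [0 x J], since [hcont] lifts [(0, j)] to an element of [K]. *)
have KJ x y j : K x -> J j -> val y = val x + (0, j) -> K y.
  move=> Kx Jj e; have [|z Kz ez] := hcont (0, j); first by split.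
  suff -> : y = x + z by exact: KD.
  by apply: val_inj; rewrite e -ez rmorphD.
rewrite eqEsubset; split=> x.
  move=> Kx; have /set_mem [r _ [j Jj e]] := valP x.
  exists r; last by exists j.
  (* Translating [x = (r, f r + j)] by [(0, - j)] yields the graph point [(r, f r)]. *)
  apply: (KJ x _ (- j)) => //; first exact: JN.
  by rewrite -e; congr pair; rewrite /= ?addr0 ?addrK.
move=> [r Kr [j Jj e]]; apply: (KJ (amalg_graph r) _ j) => //.
by rewrite -e; congr pair; rewrite /= addr0.
Qed.

End Amalgamation.

Theorem corollary6 (R S : comNzRingType) (f : {rmorphism R -> S})
    (J : set S) (hJ : ideal J) (hJrad : J `<=` jacobson S)
    (K : set (amalg f hJ)) (hK : J_ideal K)
    (hcont : [set 0] `*` J `<=` [set val x | x in K]) :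
  exists I : set R, J_ideal I /\ K = amalg_ideal f hJ I.
Proof.
(* This [I] is forced: [(r, f r)] lies in [amalg_ideal f hJ I] exactly when [r] lies in [I]. *)
exists (amalg_graph f hJ @^-1` K); split.
  exact: (J_ideal_preimage_section (@amalg_graphK _ _ f _ hJ)).
apply: amalg_ideal_preimage_graph => //.
by have [/idealr_closedP []] := hK.
Qed.
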